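(* Let $G$ be a finite complemented group with a fixed chief series $G=N_1\rhd\dots\rhd N_{k+1}=1$ and fixed complements $B_i^0$ to $N_i/N_{i+1}$ ($1\le i\le k$). Then the labeling $\lambda$ below is a dual $EL$-labeling of $\mathfrak{C}(G)$: every interval $[a,b]$ of $\mathfrak{C}(G)$ has a unique maximal chain $b=x_0\supset x_1\supset\dots\supset x_m=a$ whose labels $\lambda(x_0\supset x_1),\lambda(x_1\supset x_2),\dots$ are weakly increasing, and this chain is lexicographically first (labels read from $b$ downward) among the maximal chains of $[a,b]$.
   Context: A group $G$ is complemented if for every subgroup $H$ there is a subgroup $K$ with $HK=G$ and $H\cap K=1$. $\mathfrak{C}(G)$: right cosets of proper subgroups of $G$, together with $\emptyset$ and $G$, ordered by inclusion. A complement to $N_i/N_{i+1}$ is a subgroup $B$ with $N_iB=G$, $N_i\cap B=N_{i+1}$. For subgroups with $K_1$ maximal in $K_0$, $\lambda^{ss}(K_0\supset K_1)=\max\{i:N_iK_1\supseteq K_0\}$. Labeling of cover relations of $\mathfrak{C}(G)$: if $K_1$ is maximal in $K_0$ with $\lambda^{ss}(K_0\supset K_1)=i$, then $\lambda(K_0x\supset K_1x)=-i$ if $K_1x=K_0x\cap B_i^0$ and $=i$ otherwise; and $\lambda(\{x\}\supset\emptyset)=0$ for each $x\in G$. *)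

(* Defs.v *)
From mathcomp Require Import all_boot all_order all_algebra all_fingroup all_solvable.
Set Implicit Arguments.
Unset Strict Implicit.
Unset Printing Implicit Defensive.
Import Order.TTheory GRing.Theory Num.Theory GroupScope.

Section Labelings.
Variable T : finType.
Implicit Types (F : {set {set T}}) (X Y Z a b : {set T}) (s t : seq {set T}).

Definition covers F X Y : bool :=
  [&& X \in F, Y \in F, Y \proper X &
      [forall Z in F, ~~ ((Y \proper Z) && (Z \proper X))]].

(* The chain x_0, x_1, ..., x_m is represented by its top x_0 = b and the
   sequence s = [:: x_1; ...; x_m]. *)
Definition maximal_chain F a b s : bool :=
  path (covers F) b s && (last b s == a).

Definition chain_labels (lam : {set T} -> {set T} -> int) b s : seq int :=
  pairmap lam b s.

Definition increasing_chain lam b s : bool :=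
  sorted <=%R (chain_labels lam b s).

(* Labels are read from b downward, which is what makes this the dual notion;
   seqlexi carries the lexicographic order. *)
Definition dual_EL_labeling F (lam : {set T} -> {set T} -> int) : Prop :=
  forall a b, a \in F -> b \in F -> a \subset b ->
  exists s,
    [/\ maximal_chain F a b s,
        increasing_chain lam b s,
        (forall t, maximal_chain F a b t -> increasing_chain lam b t -> t = s)
      & (forall t, maximal_chain F a b t -> t <> s ->
          ((chain_labels lam b s : seqlexi int) < chain_labels lam b t)%O)].

End Labelings.

Section CosetLattice.
Variable gT : finGroupType.
Implicit Types (G H K : {group gT}) (N B : nat -> {group gT}) (X Y : {set gT}).

Definition complemented G : Prop :=
  forall H, H \subset G -> [splits G, over H].

Definition coset_lattice G : {set {set gT}} :=
  [set set0; (G : {set gT})] :|: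
  \bigcup_(H : {group gT} | H \proper G) rcosets H G.

(* Only N 1, ..., N k.+1 matter. *)
Definition chief_series G (k : nat) N : Prop :=
  [/\ N 1%N :=: G, N k.+1 :=: 1 &
      forall i, 1 <= i <= k -> chief_factor G (N i.+1) (N i)].

Definition complement_to_factor G N i (B0 : {group gT}) : Prop :=
  N i * B0 = G /\ N i :&: B0 = N i.+1.

Definition lambda_ss (k : nat) N X Y : nat :=
  \max_(1 <= i < k.+2 | X \subset N i * Y) i.

(* A right coset X = K :* x determines K as X * X^-1; see coset_labelE. *)
Definition coset_label (k : nat) N B X Y : int :=
  if Y == set0 then 0%R else
  let i := lambda_ss k N (X * X^-1) (Y * Y^-1) in
  if Y == X :&: B i then (- i%:Z)%R else (i%:Z)%R.

Lemma rcoset_mulV K x : (K :* x) * (K :* x)^-1 = K.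
Proof.
by rewrite invMg invg_set1 invGid mulgA -(mulgA _ [set x]) mulg_set1 mulgV
           mulg1 mulGid.
Qed.

Lemma coset_labelE k N B K0 K1 x :
  coset_label k N B (K0 :* x) (K1 :* x) =
  let i := lambda_ss k N K0 K1 in
  if K1 :* x == (K0 :* x) :&: B i then (- i%:Z)%R else (i%:Z)%R.
Proof.
rewrite /coset_label !rcoset_mulV ifF //.
by apply/negP=> /eqP/setP/(_ x); rewrite rcoset_refl inE.
Qed.

Lemma coset_label0 k N B x : coset_label k N B [set x] set0 = 0%R.
Proof. by rewrite /coset_label eqxx. Qed.

End CosetLattice.

(* Main.v *)
Require Import Defs.
From mathcomp Require Import all_boot all_order all_algebra all_fingroup all_solvable.

(* A finite complemented group is solvable with chief factors of prime order, so
   a subgroup K is governed by its set of jumps, the i for which K :&: N i is not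
   contained in N i.+1.  Passing to a maximal subgroup removes exactly one jump,
   which is the absolute value of the label.  Hence, below b and above a, the
   absolute labels of every maximal chain are the jumps of b that a lacks, and
   such an i can carry the label -i only if a is contained in B i.  The greedy
   chain always removes the jump i whose best label (-i if a is contained in B i,
   and i otherwise) is least: negative steps intersect with B i, positive ones
   pass from K to (N i.+1 :&: K) <*> L, and in both cases the cover achieving this
   label is unique.  A non-greedy first step is followed by a descent. *)

(** * Complemented groups: solvability and prime chief factors *)

Section ComplementedGroups.
Import GroupScope.
Set Implicit Arguments.
Unset Strict Implicit.
Variable gT : finGroupType.
Implicit Types G H K L M U V : {group gT}.

(** Under right translation by [M], the orbit of a coset [M :* g] other than [M] misses [M], so its
    length is less than the least prime divisor of [#|G|]; as it divides [#|G|], it is 1. Hence [M]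
    fixes every coset, which is normality. *)
Lemma index_pdiv_normal G M :
  M \subset G -> #|G : M| = pdiv #|G| -> M <| G.
Proof.
move=> sMG iM; rewrite /normal sMG; apply/subsetP=> g Gg; rewrite inE.
have [Mg | nMg] := boolP (g \in M); first by rewrite conjGid.
set O := orbit 'Rs M (M :* g).
have sO : O \subset rcosets M G :\ (M : {set gT}).
  apply/subsetP=> X /imsetP[m Mm ->]; rewrite /= !inE; apply/andP; split.
    apply: contra nMg => /eqP; rewrite rcosetE => def_M.
    have : g * m \in M :* g :* m by rewrite mem_rcoset mulgK rcoset_refl.
    by rewrite def_M groupMr.
  rewrite rcosetE -rcosetM; apply/rcosetsP; exists (g * m) => //.
  by rewrite groupM // (subsetP sMG).
have ltO : #|O| < pdiv #|G|.
  rewrite -iM; apply: leq_ltn_trans (subset_leq_card sO) _.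
  rewrite [X in _ < X](cardsD1 (M : {set gT})).
  suff -> : (M : {set gT}) \in rcosets M G by [].
  by apply/rcosetsP; exists 1; rewrite ?mulg1.
have dvO : #|O| %| #|G| by apply: dvdn_trans (dvdn_orbit _ _ _) (cardSg sMG).
have O1 : #|O| <= 1.
  rewrite leqNgt; apply/negP=> lt1O; move: ltO; apply/negP; rewrite -leqNgt.
  by apply: pdiv_min_dvd.
have sub m : m \in M -> M :* g :* m = M :* g.
  move=> Mm; apply: (card_le1_eqP O1); first exact: orbit_refl.
  by apply/imsetP; exists m; rewrite //= rcosetE.
suff sMMg : M \subset M :^ g.
  suff /eqP<- : (M : {set gT}) == M :^ g by [].
  by rewrite eqEcard sMMg cardJg leqnn.
apply/subsetP=> m Mm; rewrite mem_conjg.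
have : g * m \in M :* g by rewrite -(sub m Mm) mem_rcoset mulgK rcoset_refl.
by rewrite mem_rcoset /conjg invgK mulgA.
Qed.

(** By the modular law, a complement in [G] meets [H] in a complement in [H]. *)
Lemma complementedS G H : complemented G -> H \subset G -> complemented H.
Proof.
move=> cG sHG L sLH.
have /splitsP[K /complP[tiLK defG]] := cG L (subset_trans sLH sHG).
apply/splitsP; exists (K :&: H)%G; apply/complP; split.
  by rewrite setIA tiLK; apply/setIidPl; rewrite sub1G.
by rewrite /= group_modl // defG; apply/setIidPr.
Qed.

(* The complement of a subgroup whose order is the least prime divisor p of #|G|
   has index p, hence is normal. *)
Lemma complemented_sol G : complemented G -> solvable G.
Proof.
have [n] := ubnP #|G|; elim: n => // n IHn in G *; rewrite ltnS => leGn cG.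
have [-> | ntG] := eqVneq (G : {set gT}) 1; first exact: solvable1.
have p_pr : prime (pdiv #|G|) by rewrite pdiv_prime // cardG_gt1.
have [x Gx ox] := Cauchy p_pr (pdiv_dvd _).
have /splitsP[M /complP[tiM defG]] : [splits G, over <[x]>].
  by apply: cG; rewrite cycle_subG.
have sMG : M \subset G by rewrite -defG mulG_subr.
have oG : #|G| = (pdiv #|G| * #|M|)%N by rewrite -[in LHS]defG TI_cardMg // -ox.
have iM : #|G : M| = pdiv #|G|.
  by apply/eqP; rewrite -(eqn_pmul2r (cardG_gt0 M)) -oG mulnC Lagrange.
have nMG := index_pdiv_normal sMG iM.
rewrite (series_sol nMG); apply/andP; split.
  apply: IHn (complementedS cG sMG).
  by apply: leq_trans leGn; rewrite oG ltn_Pmull ?cardG_gt0 ?prime_gt1.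
apply: abelian_sol; apply: cyclic_abelian; apply: prime_cyclic.
by rewrite card_quotient ?normal_norm // iM.
Qed.

(* If H has prime index in U, contains V and is complemented in G by K, then
   (U :&: K) * V is normal in G = U * K, so it is all of U. *)
Lemma complemented_chief_factor_prime G V U :
  complemented G -> chief_factor G V U -> prime #|U : V|.
Proof.
move=> cG chUV; have solG := complemented_sol cG.
case/andP: (chUV) => /maxgroupP[/andP[prVU nVG] maxV] nUG.
have [sUG nUG'] := andP nUG; have sVU := proper_sub prVU.
have nVU := subset_trans sUG nVG.
have [_ _ /is_abelemP[q _ abq]] :=
  minnormal_solvable (chief_factor_minnormal chUV) (quotientS V sUG)
    (quotient_sol V solG).
have der : U^`(1) \subset V by apply: der1_min; rewrite ?(abelem_abelian abq).
have [H maxH sVH] : {H : {group gT} | maxnormal H U U & V \subset H}.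
  pose P H := (H \proper U) && (U \subset 'N(H)).
  by apply: (maxgroup_exists (gP := P)); rewrite /P prVU nVU.
have prH := index_maxnormal_sol_prime (solvableS sUG solG) maxH.
have /andP[prHU _] := maxgroupp maxH; have sHU := proper_sub prHU.
have /splitsP[K /complP[tiHK defG]] := cG H (subset_trans sHU sUG).
have defU : H * (K :&: U) = U.
  by rewrite group_modl // defG; apply/setIidPr.
have oKU : #|K :&: U| = #|U : H|.
  apply/eqP; rewrite -(eqn_pmul2l (cardG_gt0 H)) Lagrange // -[in X in _ == X]defU.
  by rewrite TI_cardMg // setIA tiHK; apply/setIidPl; rewrite sub1G.
set W := ((K :&: U) <*> V)%G.
have sKG : K \subset G by rewrite -defG mulG_subr.
have sVW : V \subset W by apply: joing_subr.
have sWU : W \subset U by rewrite join_subG subsetIr.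
(* [H] normalizes [W] because [W] contains the derived subgroup of [U], and [K] normalizes both
   generators of [W]. *)
have nWG : G \subset 'N(W).
  rewrite -defG mul_subG //.
    apply: subset_trans sHU _; apply: sub_der1_norm => //.
    exact: subset_trans der _.
  by rewrite normsY ?normsI ?normG // (subset_trans sKG).
have defW : W :=: U.
  apply/eqP; rewrite eqEproper sWU; apply/negP=> prWU.
  have WV : W :=: V by apply: maxV; rewrite ?prWU.
  have sKUV : K :&: U \subset V by rewrite -WV joing_subl.
  have KU1 : K :&: U = 1.
    apply/trivgP.
    by rewrite -tiHK subsetI subsetIl andbT (subset_trans sKUV).
  by rewrite -oKU KU1 cards1 in prH.
(* Now [U / V] is the image of [K :&: U], whose order is the prime [#|U : H|]. *)
have dvd : #|U : V| %| #|U : H|.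
  have nVKU : K :&: U \subset 'N(V) by rewrite (subset_trans _ nVU) ?subsetIr.
  rewrite -oKU -card_quotient //.
  rewrite -[in X in X %| _]defW /= quotientYidr //.
  exact: dvdn_quotient.
have n1 : #|U : V| != 1%N.
  by rewrite indexg_eq1; case/andP: prVU.
by case/primeP: (prH) => _ /(_ _ dvd); rewrite (negbTE n1) => /eqP->.
Qed.

End ComplementedGroups.

(** * Jumps of subgroups along a normal series with prime indices *)

Section Jumps.
Import GroupScope.
Set Implicit Arguments.
Unset Strict Implicit.
Variables (gT : finGroupType) (G : {group gT}) (k : nat) (N : nat -> {group gT}).
Implicit Types (H K L M : {group gT}) (X Y : {set gT}) (i j : nat).

(** Taking a set rather than a group allows the argument [X * X^-1] for every member [X] of the
    coset lattice, the empty set included. *)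
Definition jump X i := (0 < i <= k) && ~~ (N i :&: X \subset N i.+1).

Hypotheses (N1 : N 1%N :=: G) (Nk : N k.+1 :=: 1).
Hypothesis nN : forall i, 0 < i <= k.+1 -> N i <| G.
Hypothesis sN : forall i, 0 < i <= k -> N i.+1 \subset N i.
Hypothesis prN : forall i, 0 < i <= k -> prime #|N i : N i.+1|.

Lemma series_subset i j : 0 < i -> i <= j -> j <= k.+1 -> N j \subset N i.
Proof.
move=> i0; elim: j => [|j IHj]; first by rewrite leqNgt i0.
rewrite leq_eqVlt => /predU1P[-> // |]; rewrite ltnS => leij ltjk.
apply: subset_trans (IHj leij (ltnW ltjk)); apply: sN.
by rewrite (leq_trans i0 leij) -ltnS.
Qed.

Lemma series_norm i X : 0 < i <= k.+1 -> X \subset G -> X \subset 'N(N i).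
Proof. by move=> /nN/andP[_ nNG] sXG; apply: subset_trans nNG. Qed.

Lemma jumpS X Y i : X \subset Y -> jump X i -> jump Y i.
Proof.
rewrite /jump => sXY /andP[-> nX] /=; apply: contra nX; apply: subset_trans.
exact: setIS.
Qed.

(** The index of [N i.+1] in [N i] is prime, so no subgroup lies strictly between them. *)
Lemma jump_mulG K i : K \subset G -> jump K i -> (N i :&: K) * N i.+1 = N i.
Proof.
move=> sKG /andP[ik nsK].
have nNKi : N i :&: K \subset 'N(N i.+1).
  apply: series_norm; first by rewrite ltnS; case/andP: ik.
  by rewrite subIset // sKG orbT.
rewrite -norm_joinEl //; pose W := ((N i :&: K) <*> N i.+1)%G.
suff: W :=: N i by [].
have sNW : N i.+1 \subset W := joing_subr _ _.
have sWN : W \subset N i by rewrite join_subG subsetIl sN.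
apply/eqP; rewrite eqEsubset sWN -indexg_eq1 /=.
have := Lagrange_index sWN sNW; have := prN ik => /primeP[_ prNi] eqN.
have /prNi/orP[// | /eqP eqW] : #|N i : W| %| #|N i : N i.+1|.
  by rewrite -eqN dvdn_mulr.
case/negP: nsK; suff <- : W :=: N i.+1 by apply: joing_subl.
apply/eqP; rewrite eq_sym eqEsubset sNW /= -indexg_eq1.
by rewrite -(eqn_pmul2l (indexg_gt0 (N i) W)) eqN eqW muln1.
Qed.

(** Induction up the series from its trivial end shows [N i :&: K \subset L]; at a jump, the modular
    law splits [N i :&: K] into a part of [L] and a part of [N i.+1 :&: K]. *)
Lemma eq_jumps L K :
  L \subset K -> K \subset G -> (forall i, jump K i -> jump L i) -> L :=: K.
Proof.
move=> sLK sKG sj; have sLG := subset_trans sLK sKG.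
have sub m : m <= k -> N (k.+1 - m) :&: K \subset L.
  elim: m => [|m IHm] ltmk; first by rewrite subn0 Nk (setIidPl _) sub1G.
  have := IHm (ltnW ltmk); rewrite subSS.
  have -> : k.+1 - m = (k - m).+1 by rewrite subSn // ltnW.
  set i := k - m => sNKL.
  have ik : 0 < i <= k by rewrite subn_gt0 ltmk leq_subr.
  have [sNK | jL] := boolP (N i :&: K \subset N i.+1).
    by apply: subset_trans sNKL; rewrite subsetI sNK subsetIr.
  have jLi : jump L i by apply: sj; rewrite /jump ik.
  rewrite -(jump_mulG sLG jLi) setIC.
  rewrite [K :&: _]setIC -group_modl; last by rewrite subIset // sLK orbT.
  by rewrite mul_subG ?subsetIr.
apply/eqP; rewrite eqEsubset sLK /=; have := sub k (leqnn k).
by rewrite subSnn N1 (setIidPr sKG).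
Qed.


Lemma series_mulG i L :
  0 < i <= k.+1 -> L \subset G -> N i * L = N i <*> L.
Proof. by move=> ik sLG; rewrite norm_joinEr ?series_norm. Qed.

(** The index 1 qualifies since [N 1] is [G], and [k.+1] does not since [N k.+1] is trivial. So the
    default value 0 of the maximum never occurs. *)
Lemma lambda_ssP L K : L \proper K -> K \subset G ->
  let i := lambda_ss k N K L in
  [/\ 0 < i <= k, K \subset N i * L & ~~ (K \subset N i.+1 * L)].
Proof.
move=> prLK sKG; pose P i := (0 < i <= k.+1) && (K \subset N i * L).
have sLG := subset_trans (proper_sub prLK) sKG.
have P1 : P 1%N by rewrite /P N1 mulGSid.
have Pk i : P i -> i <= k.+1 by case/andP=> /andP[].
have [m /andP[/andP[m0 mk] sKm] maxm] := ex_maxnP (ex_intro P _ P1) Pk.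
have ltmk : m <= k.
  rewrite -ltnS ltn_neqAle mk andbT; apply: contraTneq prLK => eqm.
  by rewrite eqm Nk mul1g in sKm; rewrite properE sKm andbF.
have -> : lambda_ss k N K L = m.
  apply/eqP; rewrite eqn_leq; apply/andP; split.
    apply/bigmax_leqP_seq => i; rewrite mem_index_iota => ik sKi.
    by apply: maxm; rewrite /P sKi andbT; case/andP: ik => ->.
  by apply: leq_bigmax_seq; rewrite // mem_index_iota m0.
split; rewrite ?m0 //; apply/negP=> sKm1.
have /maxm : P m.+1 by rewrite /P sKm1 andbT.
by rewrite ltnn.
Qed.

(** For [Y \subset X], [jumpS] adds the reverse inclusion: the jumps of [Y] are then those of [X]
    except [i]. *)
Definition drops X Y i :=
  [/\ jump X i, ~~ jump Y i & forall j, jump X j -> j != i -> jump Y j].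

Lemma maximal_drops L K : maximal L K -> K \subset G ->
  drops K L (lambda_ss k N K L) /\ N (lambda_ss k N K L).+1 :&: K \subset L.
Proof.
move=> maxL sKG; have prLK := maxgroupp maxL; have sLK := proper_sub prLK.
have sLG := subset_trans sLK sKG.
have [] := lambda_ssP prLK sKG; set i := lambda_ss k N K L => ik sK nsK.
have [i0 lik] := andP ik.
(* [K :&: (N i.+1 <*> L)] is [L] or [K] by maximality, and the choice of [i] excludes [K]. *)
have sNKL : N i.+1 :&: K \subset L.
  have /maximal_eqP[_ /(_ (K :&: (N i.+1 <*> L))%G)[]] : maximal_eq L K.
  - by rewrite /maximal_eq maxL orbT.
  - by rewrite subsetI sLK joing_subr.
  - by rewrite subsetIl.
  - by move=> defL; rewrite -defL /= setIC setIS ?joing_subl.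
  by move/setIidPl; rewrite /= -series_mulG // (negbTE nsK).
have defK : (K :&: N i) * L = K.
  by rewrite group_modr //; apply/setIidPl.
have jKi : jump K i.
  rewrite /jump ik /=; apply/negP=> sNN; case/negP: (proper_subn prLK).
  rewrite -defK mul_subG // setIC (subset_trans _ sNKL) //.
  by rewrite subsetI sNN subsetIr.
split=> //; split=> //.
  apply: contra nsK => /(jump_mulG sLG) defN.
  rewrite (subset_trans sK) // (@series_mulG i.+1) // mul_subG ?joing_subr //.
  rewrite -defN mul_subG ?joing_subl //.
  by rewrite (subset_trans (subsetIr _ _)) ?joing_subr.
move=> j /andP[jk nsj] neji; rewrite /jump jk /=; apply: contra nsj => sLj.
(* For [j < i], the group [K] lies in [N j.+1 * L], so [K] and [L] agree modulo [N j.+1]. For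
   [j > i], [N j :&: K] already lies in [L]. *)
have [j0 ljk] := andP jk; have [ltji | leij] := ltnP j i.
  have sNij : N i \subset N j.+1 by rewrite series_subset ?(leq_trans lik).
  apply: subset_trans (setIS _ sK) _; rewrite setIC.
  apply: subset_trans (setSI _ (mulSg _ sNij)) _.
  by rewrite -group_modl ?sN // mul_subG // setIC.
apply: subset_trans sLj; rewrite subsetI subsetIl (subset_trans _ sNKL) //.
by rewrite setSI // series_subset // ?ltn_neqAle ?leij ?andbT 1?eq_sym // ltnW.
Qed.

(** An intermediate group has all jumps of [K] or only those of [L], according to whether it jumps
    at [i]; [eq_jumps] then identifies it. *)
Lemma drops_maximal L K i : L \subset K -> K \subset G -> drops K L i ->
  maximal L K /\ lambda_ss k N K L = i.
Proof.
move=> sLK sKG [jKi jLi jj].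
have neqLK : (L : {set gT}) != K by apply: contraNneq jLi => ->.
have maxL : maximal L K.
  have : maximal_eq L K.
    apply/maximal_eqP; split=> // H sLH sHK.
    have sHG := subset_trans sHK sKG.
    have [jHi | jHi] := boolP (jump H i); [right | left].
      apply: (eq_jumps sHK sKG) => j jKj; have [-> // | neji] := eqVneq j i.
      exact: jumpS sLH (jj j jKj neji).
    apply/esym; apply: (eq_jumps sLH sHG) => j jHj.
    by apply: jj (jumpS sHK jHj) _; apply: contraNneq jHi => <-.
  by rewrite /maximal_eq (negbTE neqLK).
split=> //; have [[jK jL _] _] := maximal_drops maxL sKG.
by apply/eqP; apply: contraNT jL; apply: jj.
Qed.

Lemma jump_mul_complement K H i : K \subset G -> jump K i ->
  complement_to_factor G N i H -> (N i :&: K) * H = G.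
Proof.
move=> sKG jKi [defG tiNH].
rewrite -[RHS]defG -[in RHS](jump_mulG sKG jKi) -mulgA (mulSGid (H := N i.+1)) //.
by rewrite -tiNH subsetIr.
Qed.

(** Here [K = (N i :&: K) * (K :&: H)]. For [j < i] the first factor vanishes modulo [N j.+1]; for
    [j > i] the group [N j] lies in [N i.+1], hence in [H]. *)
Lemma complement_drops K H i : K \subset G -> jump K i ->
  complement_to_factor G N i H -> drops K (K :&: H) i.
Proof.
move=> sKG jKi cHi; have [_ tiNH] := cHi.
have [ik nsK] := andP jKi; have [i0 lik] := andP ik.
have sNH : N i.+1 \subset H by rewrite -tiNH subsetIr.
have defK : (N i :&: K) * (K :&: H) = K.
  rewrite [K :&: H]setIC group_modl ?subsetIr // (jump_mul_complement sKG jKi cHi).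
  exact/setIidPr.
split=> //.
  by rewrite /jump ik negbK -tiNH setIS ?subsetIr.
move=> j jKj neji; have [jk nsj] := andP jKj; have [j0 ljk] := andP jk.
rewrite /jump jk /=; apply: contra nsj => sj.
have [ltij | leji] := ltnP i j.
  apply: subset_trans sj; rewrite subsetI subsetIl /= subsetI subsetIr /=.
  rewrite (subset_trans (subsetIl _ _)) // (subset_trans _ sNH) //.
  by rewrite series_subset // ltnW.
have sNij : N i \subset N j.+1.
  by rewrite series_subset // ?(leqW lik) // ltn_neqAle neji.
have sNj : N i :&: K \subset N j.
  by rewrite subIset // (subset_trans sNij) // sN.
rewrite setIC -defK -group_modl // mul_subG //; last by rewrite setIC.
by rewrite subIset // sNij.
Qed.

(** Jumps below [i] come from [L], those above [i] from [N i.+1 :&: K]. By the modular law the join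
    meets [N i] inside [N i.+1], since [L] does. *)
Lemma join_drops L K i : L \subset K -> K \subset G ->
    jump K i -> ~~ jump L i -> (forall j, jump K j -> j < i -> jump L j) ->
  drops K ((N i.+1 :&: K) <*> L) i.
Proof.
move=> sLK sKG jKi jLi jj; have sLG := subset_trans sLK sKG.
have [ik nsK] := andP jKi; have [i0 lik] := andP ik.
have nNL : L \subset 'N(N i.+1 :&: K).
  by rewrite normsI ?series_norm // (subset_trans sLK) ?normG.
split=> // [|j jKj neji].
  rewrite /jump ik negbK norm_joinEr // setIC -group_modl; last first.
    by rewrite subIset ?sN.
  rewrite mul_subG ?subsetIl //.
  by move: jLi; rewrite /jump ik negbK setIC.
have [ltji | leij] := ltnP j i.
  by apply: jumpS (jj j jKj ltji); apply: joing_subr.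
have [jk nsj] := andP jKj; have [j0 ljk] := andP jk.
rewrite /jump jk /=; apply: contra nsj; apply: subset_trans.
rewrite subsetI subsetIl (subset_trans _ (joing_subl _ _)) // setSI //.
by rewrite series_subset // ?ltn_neqAle 1?eq_sym ?neji // leqW.
Qed.

(** By [maximal_drops], [M] contains the join, and the join has all jumps of [M]. *)
Lemma drops_min_unique L M K i :
    L \subset M -> M \subset K -> K \subset G -> drops K M i -> ~~ jump L i ->
    (forall j, jump K j -> j < i -> jump L j) ->
  M :=: (N i.+1 :&: K) <*> L.
Proof.
move=> sLM sMK sKG dM jLi jj.
have sLK := subset_trans sLM sMK; have [jKi jMi _] := dM.
have [maxM def_i] := drops_maximal sMK sKG dM.
have [_] := maximal_drops maxM sKG; rewrite def_i => sNM.
have [_ _ jW] := join_drops sLK sKG jKi jLi jj.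
apply/esym; apply: eq_jumps => [||j jMj].
- by rewrite join_subG sNM.
- exact: subset_trans sMK sKG.
by apply: jW; [apply: jumpS jMj | apply: contraTneq jMj => ->].
Qed.

End Jumps.

(** * Labelings of set families in which greedy chains are the increasing ones *)

Section GreedyLabelings.
Set Implicit Arguments.
Unset Strict Implicit.
Import Order.TTheory.
Variables (T : finType) (F : {set {set T}}) (lam : {set T} -> {set T} -> int).
Implicit Types (a b c d : {set T}) (s t : seq {set T}).

Definition mincover a b c :=
  [/\ covers F b c, a \subset c & forall c', covers F b c' -> a \subset c' ->
      c' <> c -> (lam b c < lam b c')%R].

Lemma maximal_chain_subset a b s : maximal_chain F a b s -> a \subset b.
Proof.
elim: s b => [|c s IHs] b /=; rewrite /maximal_chain /=.
  by move/eqP->.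
case/andP=> /andP[/and4P[_ _ /proper_sub scb _] pcs] lst.
by apply: subset_trans scb; apply: IHs; rewrite /maximal_chain pcs.
Qed.

Lemma maximal_chain_cons a b c s :
  maximal_chain F a b (c :: s) = covers F b c && maximal_chain F a c s.
Proof. by rewrite /maximal_chain /= andbA. Qed.

Hypothesis ex_mincover : forall a b, a \in F -> b \in F -> a \proper b ->
  exists c, mincover a b c.
Hypothesis mincover_incr : forall a b c d, a \in F ->
  mincover a b c -> mincover a c d -> (lam b c <= lam c d)%R.
Hypothesis mincover_descent : forall a b c c', a \in F ->
  mincover a b c -> covers F b c' -> a \subset c' -> c' <> c ->
  c' <> a /\ forall d, mincover a c' d -> (lam c' d < lam b c')%R.

(** Induction on [#|b|], prefixing the greedy cover to the chain below it. An increasing chain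
    through another cover would continue greedily by induction, hence with a descent. Strict
    minimality of the first label gives the lexicographic claim. *)
Lemma mincover_dual_EL : dual_EL_labeling F lam.
Proof.
move=> a b aF bF sab.
(* The induction also records that the chain starts greedily, so that its first two labels can be
   compared. *)
suff [s [? ? ? ? _]] : exists s,
    [/\ maximal_chain F a b s, increasing_chain lam b s,
        forall t, maximal_chain F a b t -> increasing_chain lam b t -> t = s,
        forall t, maximal_chain F a b t -> t <> s ->
          ((chain_labels lam b s : seqlexi int) < chain_labels lam b t)%O
      & b <> a -> exists2 d, mincover a b d & exists s', s = d :: s'].
  by exists s.
have [n] := ubnP #|b|; elim: n => // n IHn in b bF sab *; rewrite ltnS => lebn.
have [eqab | neab] := eqVneq a b.
  have ch0 t : maximal_chain F a b t -> t = [::].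
    case: t => // c t; rewrite maximal_chain_cons eqab.
    case/andP=> /and4P[_ _ prcb _] /maximal_chain_subset.
    by rewrite (negbTE (proper_subn prcb)).
  exists [::]; split=> //; first by rewrite /maximal_chain eqab /=.
  - by move=> t /ch0->.
  - by move=> t /ch0->.
  - by rewrite eqab.
have prab : a \proper b by rewrite properEneq neab.
have [c mc] := ex_mincover aF bF prab; have [cbc sac minc] := mc.
(* The nested projections extract [d \in F] and [d \proper b] from the cover relation. *)
have IH d : covers F b d -> a \subset d -> _ := fun cbd sad =>
  IHn d (proj1 (andP (proj2 (andP cbd)))) sad
    (leq_trans (proper_card (proj1 (andP (proj2 (andP (proj2 (andP cbd))))))) lebn).
have [s [chs incs uniqs lexs heads]] := IH c cbc sac.
have uniq_t t : maximal_chain F a b t -> increasing_chain lam b t -> t = c :: s.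
  case: t => [|c' t]; first by rewrite /maximal_chain /= eq_sym (negbTE neab).
  rewrite maximal_chain_cons => /andP[cbc' cht] inct.
  have sac' := maximal_chain_subset cht.
  have inct' : increasing_chain lam c' t by apply: path_sorted inct.
  have [eqc | /eqP nec] := eqVneq c' c.
    by rewrite eqc in cht inct' *; rewrite (uniqs t).
  have [nea ltd] := mincover_descent aF mc cbc' sac' nec.
  have [s' [_ _ uniqs' _]] := IH c' cbc' sac'.
  case=> // d md [t' def_s']; case/negP: (lt_geF (ltd d md)).
  by move: inct; rewrite (uniqs' t cht inct') def_s' => /andP[].
exists (c :: s); split=> //.
- by rewrite maximal_chain_cons cbc.
- rewrite /increasing_chain /=.
  have [eqca | /eqP neca] := eqVneq c a.
    by rewrite -(uniqs [::]) // /maximal_chain eqca /=.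
  have [d md [s' def_s]] := heads neca.
  move: incs; rewrite def_s /increasing_chain /= => ->.
  by rewrite (mincover_incr aF mc md).
- case=> [|c' t]; first by rewrite /maximal_chain /= eq_sym (negbTE neab).
  rewrite maximal_chain_cons => /andP[cbc' cht] net.
  have sac' := maximal_chain_subset cht.
  rewrite /chain_labels /= ltxi_cons.
  have [eqc | /eqP nec] := eqVneq c' c.
    rewrite eqc lexx /=; rewrite eqc in cht net; apply: lexs => //.
    by move=> eqt; case: net; rewrite eqt.
  have lt_lam := minc c' cbc' sac' nec.
  by rewrite (ltW lt_lam) (lt_geF lt_lam).
by exists c => //; exists s.
Qed.

End GreedyLabelings.

(** * Labelings in which each cover removes one index from a finite set *)

Section IndexedLabelings.
Set Implicit Arguments.
Unset Strict Implicit.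
Import Order.TTheory GRing.Theory Num.Theory.
Variables (T : finType) (F : {set {set T}}) (lam : {set T} -> {set T} -> int).
Variables (n : nat) (I : {set T} -> {set 'I_n}) (B : 'I_n -> {set T}).
Implicit Types (a b c d : {set T}) (i j : 'I_n).

(* The least label available to a cover that removes the jump i and contains a. *)
Definition index_label a i : int :=
  if a \subset B i then (- (i%:Z))%R else (i%:Z)%R.

Local Notation e := index_label.

Hypothesis I_mono : forall a b, a \subset b -> I a \subset I b.
Hypothesis I_proper : forall a b, a \in F -> b \in F -> a \proper b ->
  ~~ (I b \subset I a).
Hypothesis cover_index : forall b c, covers F b c ->
  exists i, [/\ i \in I b, I c = I b :\ i &
    lam b c = if c == b :&: B i then (- (i%:Z))%R else (i%:Z)%R].
Hypothesis capB_cover : forall b i, b \in F -> i \in I b -> 0 < i ->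
  covers F b (b :&: B i) /\ I (b :&: B i) = I b :\ i.
Hypothesis ex_min_cover : forall a b i, a \in F -> b \in F -> a \subset b ->
    i \in I b :\: I a -> (forall j, j \in I b :\: I a -> (i%:Z <= e a j)%R) ->
  exists c, [/\ covers F b c, a \subset c & I c = I b :\ i].
Hypothesis min_cover_uniq : forall a b c c' i, a \in F ->
    i \in I b :\: I a -> (forall j, j \in I b :\: I a -> i <= j) ->
    covers F b c -> a \subset c -> I c = I b :\ i ->
    covers F b c' -> a \subset c' -> I c' = I b :\ i -> c' = c.

Lemma index_label_le a i : (e a i <= i%:Z)%R.
Proof.
rewrite /e; case: ifP => // _.
by apply: (@le_trans _ _ 0%R); rewrite ?oppr_le0.
Qed.

Lemma index_label_inj a : injective (e a).
Proof.
have absz_e i : `|e a i|%N = i by rewrite /e; case: ifP; rewrite ?abszN.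
by move=> i j eqe; apply: val_inj; rewrite /= -(absz_e i) eqe absz_e.
Qed.

(** A label [-i] puts [c], hence [a], inside [B i]. The second alternative is a cover that misses
    the available label [-i]; index 0 falls under the first, both signs giving 0. *)
Lemma cover_above_index a b c : covers F b c -> a \subset c ->
  exists2 i, i \in I b :\: I a & I c = I b :\ i /\
    (lam b c = e a i \/
     [/\ lam b c = (i%:Z)%R, 0 < i, a \subset B i & c <> b :&: B i]).
Proof.
move=> cbc sac; have [i [Ibi defIc ->]] := cover_index cbc.
exists i.
  rewrite inE Ibi andbT; apply/negP=> /(subsetP (I_mono sac)).
  by rewrite defIc !inE eqxx.
split=> //; rewrite /e; have [def_c | /eqP nec] := eqVneq c (b :&: B i).
  by left; rewrite (subset_trans sac) // def_c subsetIr.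
case: ifP => saB; last by left.
have [i0 | ] := posnP i; last by right.
by left; rewrite i0.
Qed.

Lemma cover_above_proper a b c : covers F b c -> a \subset c -> a \proper b.
Proof. by case/and4P=> _ _ prcb _ sac; apply: sub_proper_trans prcb. Qed.

(** Take [i] minimizing [e a] among the missing indices. As [e a] is injective and bounds labels
    from below, a competing cover of equal label removes the same [i], so uniqueness is needed only
    among those covers. *)
Lemma min_index_mincover a b : a \in F -> b \in F -> a \proper b ->
  exists c i, [/\ mincover F lam a b c, lam b c = e a i, I c = I b :\ i,
    i \in I b :\: I a & forall j, j \in I b :\: I a -> (e a i <= e a j)%R].
Proof.
move=> aF bF prab; have sab := proper_sub prab.
have [i0 Ii0] : exists i, i \in I b :\: I a.
  by apply/set0Pn; rewrite -subset0 subDset setU0 I_proper.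
case: (arg_minP (e a) Ii0) => i Ii mini.
have [iI niI] : i \in I b /\ i \notin I a by case/setDP: Ii.
suff [c [cbc sac defIc lamc uniqc]] : exists c,
    [/\ covers F b c, a \subset c, I c = I b :\ i, lam b c = e a i &
      forall c', covers F b c' -> a \subset c' -> I c' = I b :\ i ->
        lam b c' = e a i -> c' = c].
  exists c, i; split=> //; split=> // c' cbc' sac' nec.
  have [j Ij [defIc' lamc']] := cover_above_index cbc' sac'.
  rewrite lamc lt_def; apply/andP; split; last first.
    apply: le_trans (mini j Ij) _.
    by case: lamc' => [-> // | [-> _ _ _]]; apply: index_label_le.
  apply: contra_not_neq nec => eqlam; apply: uniqc => //.
  rewrite defIc'; congr (_ :\ _); apply: (@index_label_inj a); apply/eqP.
  rewrite eq_le mini // andbT -eqlam.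
  by case: lamc' => [-> // | [-> _ _ _]]; apply: index_label_le.
have [/andP[saB i_gt0] | nB] := boolP ((a \subset B i) && (0 < i)).
  have [cbB IB] := capB_cover bF iI i_gt0.
  have ltNi : (- (i%:Z) < i%:Z)%R.
    by apply: (@lt_trans _ _ 0%R); rewrite ?oppr_lt0 ltz_nat.
  have lab c : covers F b c -> I c = I b :\ i ->
      lam b c = if c == b :&: B i then (- (i%:Z))%R else (i%:Z)%R.
    move=> cbc defIc; have [j [jI defIc' ->]] := cover_index cbc.
    suff -> : i = j by [].
    apply/eqP; have : i \notin I c by rewrite defIc !inE eqxx.
    by rewrite defIc' !inE iI andbT negbK.
  exists (b :&: B i); rewrite /e saB; split=> //.
  - by rewrite subsetI sab.
  - by rewrite lab // eqxx.
  move=> c' cbc' sac' defIc'; rewrite lab //; case: eqP => // _ eqi.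
  by rewrite -eqi ltxx in ltNi.
(* Either [a] is not inside [B i], or [i] is 0 and the sign is immaterial. Since [e a j <= j], this
   [i] is also the least missing index, as [min_cover_uniq] requires. *)
have ei : e a i = (i%:Z)%R.
  move: nB; rewrite /e; case: ifP => //= _; rewrite lt0n negbK => /eqP->.
  by rewrite oppr0.
have [|c [cbc sac defIc]] := ex_min_cover aF bF sab Ii.
  by move=> j /mini; rewrite ei.
exists c; split=> //; last first.
  move=> c' cbc' sac' defIc' _.
  apply: (min_cover_uniq aF Ii) cbc sac defIc cbc' sac' defIc' => j /mini.
  by rewrite ei => /le_trans/(_ (index_label_le a j)); rewrite lez_nat.
have [j /setDP[jI njI] [defIc' lamc]] := cover_above_index cbc sac.
have eq_ij : i = j.
  apply/eqP; have : i \notin I c by rewrite defIc !inE eqxx.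
  by rewrite defIc' !inE iI andbT negbK.
rewrite -eq_ij in lamc; case: lamc => // -[_ i_gt0 saB _].
by rewrite saB i_gt0 in nB.
Qed.

Lemma mincover_uniq a b c c' :
  mincover F lam a b c -> mincover F lam a b c' -> c = c'.
Proof.
case=> cbc sac minc [cbc' sac' minc']; apply/eqP; apply/negPn/negP=> /eqP nec.
have := lt_trans (minc' c cbc sac nec) (minc c' cbc' sac' (nesym nec)).
by rewrite ltxx.
Qed.

Lemma mincover_index a b c : a \in F -> mincover F lam a b c ->
  exists i, [/\ lam b c = e a i, I c = I b :\ i, i \in I b :\: I a
    & forall j, j \in I b :\: I a -> (e a i <= e a j)%R].
Proof.
move=> aF mc; have [cbc sac _] := mc; have [bF _ _ _] := and4P cbc.
have [c' [i [mc' *]]] := min_index_mincover aF bF (cover_above_proper cbc sac).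
by rewrite (mincover_uniq mc mc'); exists i.
Qed.

(** Greedy labels increase because the second minimum is taken over fewer missing indices. *)
Theorem indexed_dual_EL : dual_EL_labeling F lam.
Proof.
apply: mincover_dual_EL => [a b aF bF prab | a b c d aF mc md |
                            a b c c' aF mc cbc' sac' nec].
- by have [c [i []]] := min_index_mincover aF bF prab; exists c.
- have [i [-> defIc _ mini]] := mincover_index aF mc.
  have [j [-> _ Ij _]] := mincover_index aF md; apply: mini.
  by move: Ij; rewrite defIc !inE => /and3P[-> _ ->].
have [i [lamc defIc Ii mini]] := mincover_index aF mc.
have [_ _ minc] := mc; have ltc := minc c' cbc' sac' nec.
have [j Ij [defIc' lamc']] := cover_above_index cbc' sac'.
(* A missing index of [c'] with a smaller best label shows that [c'] is not [a] and that its greedy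
   step is a descent. *)
suff [j' Ij' ltj'] : exists2 j', j' \in I c' :\: I a & (e a j' < lam b c')%R.
  split=> [eqc | d md]; first by rewrite eqc setDv inE in Ij'.
  have [m [-> _ _ minm]] := mincover_index aF md.
  exact: le_lt_trans (minm j' Ij') ltj'.
(* If [c'] has the best label for its index [j], the greedy index [i] differs from [j] and is still
   missing. *)
case: lamc' => [lamc' | [lamc' j0 saB nec']].
  exists i; last by rewrite -lamc.
  rewrite inE defIc' !inE; case/setDP: Ii => -> ->; rewrite andbT /=.
  by apply: contraTneq ltc => eqij; rewrite lamc lamc' eqij ltxx.
(* Otherwise [c'] has label [j] although [a] lies in [B j]. Were there no descent, [j] would be the
   least missing index, and uniqueness would force [c' = b :&: B j]. *)
have [/exists_inP[j' ? ?] | /exists_inPn noj] :=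
  boolP [exists j' in I c' :\: I a, (e a j' < lam b c')%R].
  by exists j'.
have [bF c'F prc _] := and4P cbc'; case/setDP: (Ij) => jI njI.
have sab := proper_sub (cover_above_proper cbc' sac').
have minj m : m \in I b :\: I a -> j <= m.
  move=> Im; have [-> // | nemj] := eqVneq m j.
  have /noj : m \in I c' :\: I a.
    by case/setDP: Im => mI nmI; rewrite !inE defIc' !inE nemj mI nmI.
  by rewrite -leNgt lamc' => /le_trans/(_ (index_label_le a m)); rewrite lez_nat.
have [cbB IB] := capB_cover bF jI j0.
case: nec'; apply: (min_cover_uniq aF Ij minj) cbc' sac' defIc' => //.
by rewrite subsetI sab.
Qed.

End IndexedLabelings.

(** * The coset lattice: covers, jump sets and the labeling *)

Section CosetLatticeLabeling.
Import GroupScope.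
Set Implicit Arguments.
Unset Strict Implicit.
Variables (gT : finGroupType) (G : {group gT}).
Import Order.TTheory GRing.Theory Num.Theory.
Implicit Types (H K L M : {group gT}) (X Y a b c : {set gT}) (x y : gT).

Lemma set0_coset_lattice : set0 \in coset_lattice G.
Proof. by rewrite !inE eqxx. Qed.

Lemma rcoset_coset_lattice K x :
  K \subset G -> x \in G -> K :* x \in coset_lattice G.
Proof.
move=> sKG Gx; rewrite !inE; have [eqKG | neKG] := eqVneq (K : {set gT}) G.
  by rewrite eqKG rcoset_id // eqxx orbT.
apply/orP; right; apply/bigcupP; exists K; first by rewrite properEneq neKG.
by apply/rcosetsP; exists x.
Qed.

(** Any element can be the representative, so nested cosets share one and their inclusions become
    inclusions of subgroups. *)
Lemma coset_lattice_rcoset X x : X \in coset_lattice G -> x \in X ->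
  x \in G /\ exists2 K : {group gT}, K \subset G & X = K :* x.
Proof.
rewrite !inE -orbA.
case/or3P=> [/eqP-> | /eqP-> Gx | /bigcupP[K prK /rcosetsP[z Gz ->]] Kx].
- by rewrite inE.
- by split=> //; exists G; rewrite ?rcoset_id.
have sKG := proper_sub prK; split; last by exists K => //; apply/esym/rcoset_eqP.
by have [h Kh ->] := rcosetP Kx; rewrite groupM // (subsetP sKG).
Qed.

Lemma rcoset_neq0 K x : K :* x != set0.
Proof. by apply/set0Pn; exists x; apply: rcoset_refl. Qed.

Lemma rcoset_properE K L x : (L :* x \proper K :* x) = (L \proper K).
Proof. by rewrite !properE !rcosetS. Qed.

Lemma covers_rcoset K L x : K \subset G -> x \in G ->
  covers (coset_lattice G) (K :* x) (L :* x) = maximal L K.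
Proof.
move=> sKG Gx; apply/idP/idP.
  case/and4P=> _ _; rewrite rcoset_properE => prLK /forall_inP noZ.
  apply/maxgroupP; split=> // H prHK sLH; apply/eqP.
  rewrite eq_sym eqEproper sLH /=.
  have sHG := subset_trans (proper_sub prHK) sKG.
  have := noZ _ (rcoset_coset_lattice sHG Gx).
  by rewrite !rcoset_properE prHK andbT.
case/maxgroupP=> prLK maxL; have sLG := subset_trans (proper_sub prLK) sKG.
rewrite /covers !rcoset_coset_lattice // rcoset_properE prLK /=.
apply/forall_inP=> Z FZ; apply/negP=> /andP[prLZ prZK].
have Zx : x \in Z by rewrite (subsetP (proper_sub prLZ)) ?rcoset_refl.
have [_ [H sHG defZ]] := coset_lattice_rcoset FZ Zx.
move: prLZ prZK; rewrite defZ !rcoset_properE => prLH prHK.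
by move: (prLH); rewrite (maxL H prHK (proper_sub prLH)) properxx.
Qed.

Lemma covers_set0 b :
  covers (coset_lattice G) b set0 -> exists2 x, x \in G & b = [set x].
Proof.
case/and4P=> bF _ /properP[_ [x bx _]] /forall_inP noZ.
have [Gx [K sKG def_b]] := coset_lattice_rcoset bF bx; exists x => //.
have := noZ _ (rcoset_coset_lattice (sub1G G) Gx).
rewrite mul1g proper0 -[[set x]]mul1g rcoset_neq0 /= def_b rcoset_properE.
rewrite proper1G negbK => /eqP->.
by rewrite mul1g.
Qed.

Lemma covers_set1 x : x \in G -> covers (coset_lattice G) [set x] set0.
Proof.
move=> Gx; rewrite /covers set0_coset_lattice -{1 2}[[set x]]mul1g.
rewrite (rcoset_coset_lattice (sub1G G) Gx) proper0 rcoset_neq0 /=.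
apply/forall_inP=> Z _; rewrite proper0; apply/negP=> /andP[neZ].
case/properP=> sZx [y /set1P->]; case/set0Pn: neZ => z Zz.
by rewrite -(set1P (subsetP sZx z Zz)) Zz.
Qed.

Variables (k : nat) (N : nat -> {group gT}) (B : nat -> {group gT}).

(* Index 0 is a phantom jump separating a singleton from the empty set. *)
Definition jumps X : {set 'I_k.+1} :=
  [set i : 'I_k.+1 | if i == 0 :> nat then X != set0 else jump k N (X * X^-1) i].

Lemma jumps_set0 : jumps set0 = set0.
Proof.
apply/setP=> i; rewrite !inE eqxx; case: ifP => // _.
have -> : set0 * set0^-1 = set0 :> {set gT}
  by apply/setP=> y; rewrite inE; apply/mulsgP=> -[u v]; rewrite inE.
by rewrite /jump setI0 sub0set andbF.
Qed.

Lemma jumps_rcoset K x i :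
  (i \in jumps (K :* x)) = (i == 0 :> nat) || jump k N K i.
Proof. by rewrite inE rcoset_mulV rcoset_neq0; case: ifP. Qed.

Lemma jumpsS X Y : X \subset Y -> jumps X \subset jumps Y.
Proof.
move=> sXY; apply/subsetP=> i; rewrite !inE; case: ifP => _.
  by apply: contra => /eqP Y0; rewrite -subset0 -Y0.
by apply: jumpS; rewrite mulgSS ?invSg.
Qed.

Hypotheses (N1 : N 1%N :=: G) (Nk : N k.+1 :=: 1).
Hypothesis nN : forall i, 0 < i <= k.+1 -> N i <| G.
Hypothesis sN : forall i, 0 < i <= k -> N i.+1 \subset N i.
Hypothesis prN : forall i, 0 < i <= k -> prime #|N i : N i.+1|.
Hypothesis complB : forall i, 0 < i <= k -> complement_to_factor G N i (B i).

Let F := coset_lattice G.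
Let Bi (i : 'I_k.+1) : {set gT} := B i.

Lemma ord0_jumps X : (ord0 \in jumps X) = (X != set0).
Proof. by rewrite inE. Qed.

Lemma jumps_set1 x : jumps [set x] = [set ord0].
Proof.
apply/setP=> i; rewrite -[[set x]]mul1g jumps_rcoset inE -val_eqE /=.
by rewrite /jump subIset ?sub1G ?orbT // andbF orbF.
Qed.

Lemma jumps_drops K L x (i : 'I_k.+1) : L \subset K -> drops k N K L i ->
  jumps (L :* x) = jumps (K :* x) :\ i.
Proof.
move=> sLK [jKi jLi jj]; apply/setP=> j; rewrite in_setD1 !jumps_rcoset.
have i_gt0 : 0 < i by case/andP: jKi => /andP[].
have [-> | neji] := eqVneq j i; first by rewrite (negbTE jLi) orbF eqn0Ngt i_gt0.
rewrite /=; congr orb; apply/idP/idP=> [|jKj]; first exact: jumpS.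
exact: jj jKj neji.
Qed.

Lemma drops_jumps K L x (i : 'I_k.+1) : i \in jumps (K :* x) -> 0 < i ->
  jumps (L :* x) = jumps (K :* x) :\ i -> drops k N K L i.
Proof.
move=> Ii i_gt0 defIL; split.
- by move: Ii; rewrite jumps_rcoset eqn0Ngt i_gt0.
- have : i \notin jumps (L :* x) by rewrite defIL !inE eqxx.
  by rewrite jumps_rcoset eqn0Ngt i_gt0.
move=> j jKj neji; have /andP[/andP[j0 jk] _] := jKj; rewrite -ltnS in jk.
have : Ordinal jk \in jumps (L :* x).
  by rewrite defIL in_setD1 jumps_rcoset jKj orbT andbT -val_eqE.
by rewrite jumps_rcoset eqn0Ngt /= j0.
Qed.

Lemma subset_jumps_eq K L x : L \subset K -> K \subset G ->
  jumps (K :* x) \subset jumps (L :* x) -> L :=: K.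
Proof.
move=> sLK sKG /subsetP sI; apply: (eq_jumps N1 Nk nN sN prN) => // j jKj.
have /andP[/andP[j0 jk] _] := jKj; rewrite -ltnS in jk.
have /sI : Ordinal jk \in jumps (K :* x) by rewrite jumps_rcoset jKj orbT.
by rewrite jumps_rcoset eqn0Ngt /= j0.
Qed.

Lemma jumps_proper a b : a \in F -> b \in F -> a \proper b ->
  ~~ (jumps b \subset jumps a).
Proof.
move=> aF bF prab; have [a0 | /set0Pn[x ax]] := eqVneq a set0.
  apply/subsetPn; exists ord0; rewrite ord0_jumps ?a0 ?eqxx //.
  by rewrite -proper0 -a0.
have [Gx [L sLG def_a]] := coset_lattice_rcoset aF ax.
have [_ [K sKG def_b]] := coset_lattice_rcoset bF (subsetP (proper_sub prab) x ax).
move: prab; rewrite def_a def_b rcoset_properE => prLK; apply/negP=> sI.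
by move: (prLK); rewrite (subset_jumps_eq (proper_sub prLK) sKG sI) properxx.
Qed.

Lemma covers_jumps b c : covers F b c ->
  exists i, [/\ i \in jumps b, jumps c = jumps b :\ i &
    coset_label k N B b c =
      if c == b :&: Bi i then (- (i%:Z))%R else (i%:Z)%R].
Proof.
move=> cbc; have [bF cF prcb _] := and4P cbc.
have [c0 | /set0Pn[x cx]] := eqVneq c set0.
  have [x Gx ->] := covers_set0 (etrans (congr1 _ (esym c0)) cbc).
  (* The cover of the empty set by a singleton removes the phantom index, whose label is 0 with
     either sign. *)
  exists ord0; rewrite jumps_set1 c0 jumps_set0 inE /coset_label eqxx.
  by split=> //; [apply/setP=> j; rewrite !inE andNb | case: ifP].
have [Gx [L sLG def_c]] := coset_lattice_rcoset cF cx.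
have [_ [K sKG def_b]] := coset_lattice_rcoset bF (subsetP (proper_sub prcb) x cx).
move: cbc; rewrite def_b def_c covers_rcoset // => maxL.
have [dL _] := maximal_drops N1 Nk nN sN prN maxL sKG.
have [jK _ _] := dL; have /andP[/andP[_ lek] _] := jK; rewrite -ltnS in lek.
exists (Ordinal lek); split; last by rewrite coset_labelE.
  by rewrite jumps_rcoset jK orbT.
exact: (@jumps_drops K L x (Ordinal lek) (proper_sub (maxgroupp maxL)) dL).
Qed.

Lemma covers_setI_complement b i : b \in F -> i \in jumps b -> 0 < i ->
  covers F b (b :&: Bi i) /\ jumps (b :&: Bi i) = jumps b :\ i.
Proof.
move=> bF Ii i_gt0; have /set0Pn[z bz] : b != set0.
  by apply: contraTneq Ii => ->; rewrite jumps_set0 inE.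
have [Gz [K sKG def_b]] := coset_lattice_rcoset bF bz.
have jKi : jump k N K i by move: Ii; rewrite def_b jumps_rcoset eqn0Ngt i_gt0.
have cBi : complement_to_factor G N i (B i) by apply: complB; case/andP: jKi.
(* This moves the representative into [B i]: then [b = K :* y] with [y \in B i], and [b :&: B i] is
   the coset [(K :&: B i) :* y]. *)
have : z \in (N i :&: K) * B i.
  by rewrite (jump_mul_complement nN sN prN sKG jKi cBi).
case/mulsgP=> h y /setIP[_ Kh] By def_z.
have sBG : B i \subset G by case: cBi => <- _; apply: mulG_subr.
have Gy := subsetP sBG y By.
have {}def_b : b = K :* y.
  by rewrite def_b def_z rcosetM (rcoset_id Kh).
have def_bB : b :&: Bi i = (K :&: B i) :* y.
  apply/setP=> u.
  by rewrite def_b mem_rcoset !inE mem_rcoset (groupMr _ (groupVr By)).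
have sKBK : K :&: B i \subset K := subsetIl _ _.
have dK := complement_drops nN sN prN sKG jKi cBi.
have [maxKB _] := drops_maximal N1 Nk nN sN prN sKBK sKG dK.
by rewrite def_bB def_b covers_rcoset //; split=> //; apply: jumps_drops.
Qed.

Lemma ex_cover_min_jump a b i : a \in F -> b \in F -> a \subset b ->
    i \in jumps b :\: jumps a ->
    (forall j, j \in jumps b :\: jumps a -> (i%:Z <= index_label Bi a j)%R) ->
  exists c, [/\ covers F b c, a \subset c & jumps c = jumps b :\ i].
Proof.
move=> aF bF sab /setDP[ib nia] mini.
have [a0 | /set0Pn[x ax]] := eqVneq a set0.
  (* The empty set lies in every [B j], so the hypothesis reads [i <= - j]. Thus [b] has only the
     phantom jump and is a singleton. *)
  have all0 j : j \in jumps b -> i = 0 :> nat /\ j = 0 :> nat.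
    move=> jb; have := mini j; rewrite inE jb a0 jumps_set0 inE => /(_ isT).
    rewrite /index_label sub0set; case: (val i) (val j) => [|m] [|n] //.
  have /set0Pn[x bx] : b != set0.
    by apply: contraTneq ib => ->; rewrite jumps_set0 inE.
  have [Gx [K sKG def_b]] := coset_lattice_rcoset bF bx.
  have K1 : 1%G :=: K.
    apply: (@subset_jumps_eq _ _ x); rewrite ?sub1G // -def_b.
    apply/subsetP=> j /all0[_ j0]; rewrite jumps_rcoset j0 eqxx //.
  have {}def_b : b = [set x] by rewrite def_b -K1 mul1g.
  exists set0; rewrite a0 sub0set def_b jumps_set1 jumps_set0; split=> //.
    exact: covers_set1.
  have -> : i = ord0 by apply/val_inj; case: (all0 i ib).
  by apply/setP=> j; rewrite !inE andNb.
have [Gx [L sLG def_a]] := coset_lattice_rcoset aF ax.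
have [_ [K sKG def_b]] := coset_lattice_rcoset bF (subsetP sab x ax).
have sLK : L \subset K by rewrite -(rcosetS x) -def_a -def_b.
move: nia ib; rewrite {1}def_a {1}def_b !jumps_rcoset negb_or.
case/andP=> i0 jLi; rewrite (negbTE i0) /= => jKi.
(* A missing [j] satisfies [i <= e a j <= j], so no jump below [i] is missing and [join_drops]
   supplies the cover. *)
have jj j : jump k N K j -> j < i -> jump k N L j.
  move=> jKj ltji; apply: contraLR ltji => jLj.
  have /andP[/andP[j0 jk] _] := jKj; rewrite -ltnS in jk.
  have /mini : Ordinal jk \in jumps b :\: jumps a.
    by rewrite inE def_a def_b !jumps_rcoset jKj (negbTE jLj) orbT eqn0Ngt j0.
  by move/le_trans/(_ (index_label_le _ _ _)); rewrite lez_nat -leqNgt.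
have dK := join_drops nN sN sLK sKG jKi jLi jj.
have sMK : (N i.+1 :&: K) <*> L \subset K by rewrite join_subG subsetIr.
have [maxM _] := drops_maximal N1 Nk nN sN prN sMK sKG dK.
exists (((N i.+1 :&: K) <*> L) :* x); rewrite def_a def_b covers_rcoset //.
by rewrite rcosetS joing_subr; split=> //; apply: jumps_drops.
Qed.

Lemma cover_min_jump_uniq a b c c' i : a \in F ->
    i \in jumps b :\: jumps a -> (forall j, j \in jumps b :\: jumps a -> i <= j) ->
    covers F b c -> a \subset c -> jumps c = jumps b :\ i ->
    covers F b c' -> a \subset c' -> jumps c' = jumps b :\ i -> c' = c.
Proof.
move=> aF /setDP[ib nia] mini cbc sac Ic cbc' sac' Ic'.
have [bF cF prcb _] := and4P cbc; have [_ c'F prcb' _] := and4P cbc'.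
have [a0 | /set0Pn[x ax]] := eqVneq a set0.
  (* For empty [a] the phantom index is missing and least, and a set without it is empty. *)
  have i0 : i = ord0.
    apply/val_inj/eqP; rewrite /= -leqn0; apply: (mini ord0).
    rewrite inE a0 jumps_set0 inE ord0_jumps.
    by apply: contraTneq prcb => ->; rewrite properE sub0set andbF.
  have c0 d : jumps d = jumps b :\ i -> d = set0.
    by move=> Id; apply/eqP/negPn; rewrite -ord0_jumps Id i0 !inE eqxx.
  by rewrite (c0 c Ic) (c0 c' Ic').
have [Gx [L sLG def_a]] := coset_lattice_rcoset aF ax.
have [_ [K sKG def_b]] :=
  coset_lattice_rcoset bF (subsetP (proper_sub prcb) x (subsetP sac x ax)).
have [_ [M sMG def_c]] := coset_lattice_rcoset cF (subsetP sac x ax).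
have [_ [M' sMG' def_c']] := coset_lattice_rcoset c'F (subsetP sac' x ax).
have [i0 jLi] : 0 < i /\ ~~ jump k N L i.
  by move: nia; rewrite def_a jumps_rcoset negb_or lt0n => /andP.
have jj j : jump k N K j -> j < i -> jump k N L j.
  move=> jKj ltji; apply: contraLR ltji => jLj.
  have /andP[/andP[j0 jk] _] := jKj; rewrite -ltnS in jk.
  have /mini : Ordinal jk \in jumps b :\: jumps a.
    by rewrite inE def_a def_b !jumps_rcoset jKj (negbTE jLj) orbT eqn0Ngt j0.
  by rewrite -leqNgt.
have defM H : a \subset H :* x -> H :* x \proper b ->
    jumps (H :* x) = jumps b :\ i -> H :=: (N i.+1 :&: K) <*> L.
  rewrite def_a def_b rcosetS rcoset_properE => sLH /proper_sub sHK IH.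
  apply: (drops_min_unique N1 Nk nN sN prN) jLi jj => //.
  by apply: drops_jumps IH; rewrite -?def_b.
rewrite def_c def_c' in sac sac' Ic Ic' prcb prcb' *.
by rewrite (defM M) // (defM M').
Qed.

Lemma coset_label_dual_EL : dual_EL_labeling F (coset_label k N B).
Proof.
apply: (indexed_dual_EL jumpsS jumps_proper covers_jumps covers_setI_complement).
  exact: ex_cover_min_jump.
exact: cover_min_jump_uniq.
Qed.

End CosetLatticeLabeling.

Theorem theorem4p8 (gT : finGroupType) (G : {group gT})
    (k : nat) (N B : nat -> {group gT})
    (complG : complemented G)
    (chiefN : chief_series G k N)
    (complB : forall i : nat, (1 <= i <= k)%N -> complement_to_factor G N i (B i)) :
  dual_EL_labeling (coset_lattice G) (coset_label k N B).
Proof.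
have [N1 Nk chN] := chiefN.
apply: coset_label_dual_EL => // [i /andP[i0] | i ik | i ik].
(* [N k.+1] is the top of no chief factor; it is normal because it is trivial. *)
- rewrite leq_eqVlt => /predU1P[-> | ltik]; first by rewrite Nk normal1.
  by have /andP[] : chief_factor G (N i.+1) (N i) by apply: chN; rewrite i0.
- by case/andP: (chN i ik) => /maxgroupp/andP[/proper_sub].
exact: complemented_chief_factor_prime complG (chN i ik).
Qed.
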